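(* Let $R$ be a ring (associative with identity, not necessarily commutative), and let $\mathrm{IPO}(R)$ be the set of all subsets $A\subseteq R$ of the form $A=IJ$, where each of $I$ and $J$ is a left ideal or a right ideal of $R$. Then $\mathrm{IPO}(R)$ is a semigroup under multiplication.
   Context: For additive subgroups $A,B$ of $R$ (in particular for one-sided ideals), the product $AB$ is the additive subgroup generated by $\{ab : a\in A, b\in B\}$, i.e. the set of all finite sums of such products. This is the multiplication referred to in the claim. In $IJ$, $I$ and $J$ may be one-sided ideals of the same or of different sides. *)

(* Defs.v *)
From mathcomp Require Import all_boot all_algebra.
From mathcomp Require Import all_classical.

Set Implicit Arguments.
Unset Strict Implicit.
Unset Printing Implicit Defensive.

Import GRing.Theory.
Local Open Scope classical_set_scope.
Local Open Scope ring_scope.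

(* Rings are [pzRingType]: associative and unital, the zero ring included.
   MathComp's own ideals ([idealr_closed]) are proper by definition, which
   would exclude A = R, hence the definitions below.                         *)

Definition additive_subgroup (V : zmodType) (A : set V) : Prop :=
  zmod_closed (mem A).

Definition left_ideal (R : pzRingType) (I : set R) : Prop :=
  additive_subgroup I /\ (forall r x, I x -> I (r * x)).

Definition right_ideal (R : pzRingType) (I : set R) : Prop :=
  additive_subgroup I /\ (forall r x, I x -> I (x * r)).

Definition one_sided_ideal (R : pzRingType) (I : set R) : Prop :=
  left_ideal I \/ right_ideal I.

Definition generated_subgroup (V : zmodType) (X : set V) : set V :=
  smallest (@additive_subgroup V) X.

(* Not the elementwise product of sets: see [mul_subgroupE]. *)
Definition mul_subgroup (R : pzRingType) (A B : set R) : set R :=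
  generated_subgroup [set a * b | a in A & b in B].

Definition IPO (R : pzRingType) : set (set R) :=
  [set A | exists I J : set R,
     [/\ one_sided_ideal I, one_sided_ideal J & A = mul_subgroup I J]].
Arguments IPO R : clear implicits.

Definition semigroup_under (T : Type) (S : set T) (op : T -> T -> T) : Prop :=
  (forall x y, S x -> S y -> S (op x y)) /\
  (forall x y z, S x -> S y -> S z -> op x (op y z) = op (op x y) z).

Lemma additive_subgroupP (V : zmodType) (A : set V) :
  additive_subgroup A <-> A 0 /\ (forall x y, A x -> A y -> A (x - y)).
Proof.
split=> [[/set_mem A0 AB]|[A0 AB]].
  by split=> // x y Ax Ay; apply/set_mem/AB; apply/mem_set.
split; first exact/mem_set.
by move=> x y /set_mem Ax /set_mem Ay; apply/mem_set/AB.
Qed.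

(* The product is the set of all finite sums of products a * b. *)
Lemma mul_subgroupE (R : pzRingType) (A B : set R) : additive_subgroup A ->
  mul_subgroup A B =
    [set x | exists n (a b : 'I_n -> R),
       [/\ forall i, A (a i), forall i, B (b i) & x = \sum_i a i * b i]].
Proof.
move=> /additive_subgroupP[A0 AB].
have AN x : A x -> A (- x) by move=> Ax; rewrite -(sub0r x); apply: AB.
apply/seteqP; split.
  apply: smallest_sub; last first.
    move=> _ [a Aa [b Bb <-]]; exists 1, (fun=> a), (fun=> b).
    by split=> //; rewrite big_ord1.
  apply/additive_subgroupP; split.
    by exists 0, (fun=> 0), (fun=> 0); split=> [[]|[]|] //; rewrite big_ord0.
  move=> _ _ [m [a [b [Aa Bb ->]]]] [n [c [d [Ac Bd ->]]]].
  exists (m + n)%N,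
    (fun i : 'I_(m + n) =>
       match fintype.split i with inl j => a j | inr j => - c j end),
    (fun i : 'I_(m + n) =>
       match fintype.split i with inl j => b j | inr j => d j end).
  split=> [i|i|]; try by case: (fintype.split i) => j //; exact: AN.
  rewrite big_split_ord /= -sumrN; congr (_ + _); apply: eq_bigr => i _.
    by rewrite (unsplitK (inl i : 'I_m + 'I_n)).
  by rewrite (unsplitK (inr i : 'I_m + 'I_n)) mulNr.
move=> _ [n [a [b [Aa Bb ->]]]] S [/additive_subgroupP[S0 SB] ABS].
elim/big_ind: _ => // [x y Sx Sy|i _]; last first.
  by apply: ABS; exists (a i) => //; exists (b i).
by rewrite -(opprK y); apply: (SB _ _ Sx); rewrite -sub0r; apply: SB.
Qed.

(* Main.v *)
Require Import Defs.
From mathcomp Require Import all_boot all_algebra.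
From mathcomp Require Import all_classical.

(** Multiplication of subsets is associative, because a one-sided multiplication
    [x |-> a * x] or [x |-> x * c] is additive, so that once it sends
    all products [b * c], or [a * b], into a given subgroup, it also sends their
    sums there ([mul_subgroup_ind], [mul_subgroupA]).
    A product inherits sidedness from its outer factors: it is a left ideal when
    its first factor is one, and a right ideal when its last factor is one
    ([left_ideal_mul], [right_ideal_mul]).

    Closure is then a matter of bracketing [I J K L] into two one-sided ideals,
    and the sides of the inner factors tell where.  If [K] is a right ideal, so
    is [I J K], and the bracketing is [(I J K) L].  If [J] is a left ideal, so is
    [J K L], and the bracketing is [I (J K L)].  Otherwise [J] is a right and [K]
    a left ideal, so that in [(I J) (K L)] the first factor is a right ideal and
    the second a left ideal. *)

Set Implicit Arguments.
Unset Strict Implicit.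
Unset Printing Implicit Defensive.

Import GRing.Theory.
Local Open Scope classical_set_scope.
Local Open Scope ring_scope.

Lemma additive_subgroup_preimage (U V : zmodType) (f : U -> V) (S : set V) :
  {morph f : x y / x - y} -> additive_subgroup S -> additive_subgroup (f @^-1` S).
Proof.
move=> fB /additive_subgroupP[S0 SB]; apply/additive_subgroupP.
split=> [|x y Sx Sy] /=; last by rewrite fB; exact: SB.
by rewrite -(subrr 0) fB subrr.
Qed.

Lemma additive_subgroup_generated (V : zmodType) (X : set V) :
  additive_subgroup (generated_subgroup X).
Proof.
apply/additive_subgroupP; split=> [S [/additive_subgroupP[]] //|x y Xx Xy S SX].
have [/additive_subgroupP[_ SB] _] := SX.
by apply: SB; [exact: Xx|exact: Xy].
Qed.

Section Products.
Variable R : pzRingType.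
Implicit Types A B C S : set R.

Lemma additive_subgroup_mul A B : additive_subgroup (mul_subgroup A B).
Proof. exact: additive_subgroup_generated. Qed.

Lemma mem_mul_subgroup A B a b : A a -> B b -> mul_subgroup A B (a * b).
Proof. by move=> Aa Bb S [_]; apply; exists a => //; exists b. Qed.

(** The universal property of the product, with the target pulled back along
    an additive map: an additive condition on the elements of a product need
    only be tested on the generators [a * b]. *)
Lemma mul_subgroup_ind A B (V : zmodType) (f : R -> V) (S : set V) :
  {morph f : x y / x - y} -> additive_subgroup S ->
  (forall a b, A a -> B b -> S (f (a * b))) ->
  forall x, mul_subgroup A B x -> S (f x).
Proof.
move=> fB addS SAB x; apply: (_ : mul_subgroup A B `<=` f @^-1` S).
apply: smallest_sub; first exact: additive_subgroup_preimage.
by move=> _ [a Aa [b Bb <-]]; exact: SAB.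
Qed.

Lemma mul_subgroup_sub A B S : additive_subgroup S ->
  (forall a b, A a -> B b -> S (a * b)) -> mul_subgroup A B `<=` S.
Proof. by move=> addS SAB; apply: (@mul_subgroup_ind A B R id). Qed.

Lemma mul_subgroupA A B C :
  mul_subgroup A (mul_subgroup B C) = mul_subgroup (mul_subgroup A B) C.
Proof.
apply/seteqP; split.
  apply: mul_subgroup_sub => [|a x Aa]; first exact: additive_subgroup_mul.
  apply: (mul_subgroup_ind (f := *%R a)) => [||b c Bb Cc].
  - exact: mulrBr.
  - exact: additive_subgroup_mul.
  by rewrite mulrA; do 2?apply: mem_mul_subgroup.
apply: mul_subgroup_sub => [|x c + Cc]; first exact: additive_subgroup_mul.
apply: (mul_subgroup_ind (f := *%R^~ c)) => [||a b Aa Bb].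
- by move=> x1 x2; exact: mulrBl.
- exact: additive_subgroup_mul.
by rewrite -mulrA; do 2?apply: mem_mul_subgroup.
Qed.

Lemma left_ideal_mul A B : left_ideal A -> left_ideal (mul_subgroup A B).
Proof.
move=> [_ lA]; split=> [|r]; first exact: additive_subgroup_mul.
apply: (mul_subgroup_ind (f := *%R r)) => [||a b Aa Bb].
- exact: mulrBr.
- exact: additive_subgroup_mul.
by rewrite mulrA; apply: mem_mul_subgroup => //; exact: lA.
Qed.

Lemma right_ideal_mul A B : right_ideal B -> right_ideal (mul_subgroup A B).
Proof.
move=> [_ rB]; split=> [|r]; first exact: additive_subgroup_mul.
apply: (mul_subgroup_ind (f := *%R^~ r)) => [||a b Aa Bb].
- by move=> x1 x2; exact: mulrBl.
- exact: additive_subgroup_mul.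
by rewrite -mulrA; apply: mem_mul_subgroup => //; exact: rB.
Qed.

Lemma IPO_mul A B : IPO R A -> IPO R B -> IPO R (mul_subgroup A B).
Proof.
move=> [I [J [oI oJ ->]]] [K [L [oK oL ->]]].
case: oK => [lK|rK]; last first.
  exists (mul_subgroup (mul_subgroup I J) K), L.
  by split=> //; [right; exact: right_ideal_mul | rewrite mul_subgroupA].
case: oJ => [lJ|rJ].
  exists I, (mul_subgroup J (mul_subgroup K L)).
  by split=> //; [left; exact: left_ideal_mul | rewrite -mul_subgroupA].
exists (mul_subgroup I J), (mul_subgroup K L).
by split=> //; [right; exact: right_ideal_mul | left; exact: left_ideal_mul].
Qed.

End Products.

Theorem proposition2p1 (R : pzRingType) :
  semigroup_under (IPO R) (@mul_subgroup R).
Proof.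
split=> [A B|A B C _ _ _]; first exact: IPO_mul.
exact: mul_subgroupA.
Qed.
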